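(* Let $p$ and $r$ be distinct primes with $p\equiv1\pmod3$ and $\gcd(3,r)=1$. Let $t\ge1$, $m=3t$, $q=p^m$, $c=\frac{q-1}{3}$ and $k=\frac3r\Psi_r(q)$, and assume $q\equiv1\pmod r$. Let $a,b$ be integers with $4p^t=a^2+27b^2$, $a\equiv1\pmod3$ and $\gcd(a,p)=1$. For non-negative integers $\ell_1,\ell_2,\ell_3$ with $h=\ell_1+\ell_2+\ell_3\le r$ put $$w_{\ell_1,\ell_2,\ell_3}=\tfrac{p-1}{3p}\Big(hq+\big(a(\tfrac{\ell_2+\ell_3}{2}-\ell_1)+\tfrac{9b}{2}(\ell_2-\ell_3)\big)p^t\Big),\qquad A_{\ell_1,\ell_2,\ell_3}=\binom{r}{h}\binom{h}{\ell_1,\ell_2,\ell_3}c^h.$$ Then the weights of $\mathcal{C}(k,q^r)$ are the numbers $w_{\ell_1,\ell_2,\ell_3}$, with frequencies $A_{\ell_1,\ell_2,\ell_3}$ (frequencies of tuples giving the same weight being added).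
   Context: $\Psi_r(x)=x^{r-1}+\cdots+x+1$. Let $Q=p^M$, $\omega$ a primitive element of $\mathbb{F}_Q$, $k\mid Q-1$, $n=\frac{Q-1}{k}$. The irreducible cyclic code $\mathcal{C}(k,Q)\subseteq\mathbb{F}_p^n$ consists of the words $c_\gamma=(\mathrm{Tr}_{Q/p}(\gamma\,\omega^{ki}))_{i=0}^{n-1}$, $\gamma\in\mathbb{F}_Q$; the weight of a word is its number of nonzero coordinates, and the frequency of $w$ is $\#\{\gamma\in\mathbb{F}_Q: w(c_\gamma)=w\}$. *)

(* Defs.v *)
From HB Require Import structures.
From mathcomp Require Import all_boot all_order all_algebra all_field.
Set Implicit Arguments. Unset Strict Implicit. Unset Printing Implicit Defensive.
Import Order.TTheory GRing.Theory Num.Theory.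

Definition Psi (r x : nat) : nat := (\sum_(i < r) x ^ i)%N.

Local Open Scope ring_scope.

(* absolute trace Tr_{Q/p}(x) = sum_{i<M} x^(p^i), for F of order p^M *)
Definition trace_abs (F : finFieldType) (p M : nat) (x : F) : F :=
  \sum_(i < M) x ^+ (p ^ i).

Definition cw_weight (F : finFieldType) (p M k : nat) (omega gamma : F) : nat :=
  #|[set i : 'I_((#|F|.-1) %/ k) |
      trace_abs p M (gamma * omega ^+ (k * i)) != 0]|.

Definition cw_freq (F : finFieldType) (p M k : nat) (omega : F) (w : nat) : nat :=
  #|[set gamma : F | cw_weight p M k omega gamma == w]|.

Definition multinom3 (l1 l2 l3 : nat) : nat :=
  ((l1 + l2 + l3)`! %/ (l1`! * l2`! * l3`!))%N.

(* Main.v *)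
Require Import Defs.
From HB Require Import structures.
From mathcomp Require Import all_boot all_order all_algebra all_field.
From mathcomp Require Import zify ring.
Set Implicit Arguments. Unset Strict Implicit. Unset Printing Implicit Defensive.
Import Order.TTheory GRing.Theory Num.Theory.
Local Open Scope ring_scope.

(** Let [K] be the subfield of order [q = p ^ (3 t)] of [F], [c = (q - 1) / 3] and
    [beta = omega ^ k].  The powers [beta ^ j], [j < r], form a Kummer basis of [F]
    over [K], and the code coordinates run over [beta ^ j * u] for [j < r] and [u] a
    nonzero cube of [K].  Hence [gamma |-> (Tr_{F/K} (gamma beta ^ j))_j] is a
    bijection of [F] onto [K ^ r] that turns the weight into a sum of [r] values of
    the function [N (y) = #{u a nonzero cube of K | Tr_{K/p} (y u) <> 0}], and the
    weight enumerator of the code is the [r]-th power of that of [N].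

    For [y <> 0], [N (y)] depends only on the cubic class of [y], through the cubic
    exponential sum [G (y) = \sum_x psi (y x ^ 3)]:
    [3 p N (y) = (p - 1) (q - G (y))].  The three values of [G] are integers
    congruent to 1 modulo 3.  Their first three power sums count the zeros of
    diagonal cubic forms; the number of zeros of [x ^ 3 + y ^ 3 + z ^ 3] is
    congruent to [(3 c)! / c! ^ 3] modulo [p], hence prime to [p].  It follows that
    the three values are [p ^ t u_i] with [u_i] prime to [p], [\sum_i u_i = 0] and
    [\sum_i u_i ^ 2 = 6 p ^ t], and the uniqueness of the representation
    [4 p ^ t = a ^ 2 + 27 b ^ 2] gives [{u_i} = {a, - (a + 9 b) / 2, - (a - 9 b) / 2}]. *)

(** * Traces and additive characters *)

Section FrobeniusTrace.

Variables (K : finFieldType) (p : nat).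
Hypothesis pcharKp : p \in [pchar K].

Lemma exprD_pchar_pow i (x y : K) :
  (x + y) ^+ (p ^ i) = x ^+ (p ^ i) + y ^+ (p ^ i).
Proof.
apply: exprDn_pchar; rewrite pnatX; apply/orP; left.
by rewrite pnatE ?(pcharf_prime pcharKp).
Qed.

Lemma expr0_pchar_pow i : (0 : K) ^+ (p ^ i) = 0.
Proof. by rewrite expr0n eqn0Ngt expn_gt0 prime_gt0 ?(pcharf_prime pcharKp). Qed.

Lemma expr_sum_pchar_pow i (I : Type) (s : seq I) (f : I -> K) :
  (\sum_(j <- s) f j) ^+ (p ^ i) = \sum_(j <- s) f j ^+ (p ^ i).
Proof.
apply: (big_morph (fun x => x ^+ (p ^ i))); last exact: expr0_pchar_pow.
exact: exprD_pchar_pow.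
Qed.

Lemma trace_absD m (x y : K) :
  trace_abs p m (x + y) = trace_abs p m x + trace_abs p m y.
Proof.
by rewrite /trace_abs -big_split; apply: eq_bigr => i _; rewrite exprD_pchar_pow.
Qed.

Lemma trace_abs0 m : trace_abs p m (0 : K) = 0.
Proof. by rewrite /trace_abs big1 // => i _; rewrite expr0_pchar_pow. Qed.

Lemma trace_abs_fixed m (x : K) :
  x ^+ (p ^ m) = x -> trace_abs p m x ^+ p = trace_abs p m x.
Proof.
move=> xq; have := expr_sum_pchar_pow 1 (index_enum 'I_m) (fun i => x ^+ (p ^ i)).
rewrite expn1 -/(trace_abs p m x) => ->.
case: m xq => [|m] xq; first by rewrite /trace_abs !big_ord0.
rewrite /trace_abs big_ord_recr /= -exprM -expnSr xq [in RHS]big_ord_recl addrC.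
by congr (_ + _); apply: eq_bigr => i _; rewrite -exprM -expnSr.
Qed.

(** The [p] elements [n%:R] are distinct roots of ['X^p - 'X], so one more root would exceed the
    degree. *)
Lemma prime_subfieldP (x : K) : x ^+ p = x -> exists n : 'I_p, x = n%:R.
Proof.
move=> xp; have p_gt1 := prime_gt1 (pcharf_prime pcharKp).
pose rs := [seq (n%:R : K) | n <- iota 0 p].
have [/mapP[n]|xNrs] := boolP (x \in rs).
  by rewrite mem_iota /= => lt_np ->; exists (Ordinal lt_np).
have nz : ('X^p - 'X : {poly K}) != 0.
  by rewrite -size_poly_gt0 size_polyDl ?size_polyXn // size_polyN size_polyX.
have rs_root : all (root ('X^p - 'X)) (x :: rs).
  rewrite /= rootE !hornerE xp subrr eqxx /=; apply/allP => _ /mapP[n _ ->].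
  by rewrite rootE !hornerE -(pFrobenius_autE pcharKp) pFrobenius_aut_nat subrr.
have rs_uniq : uniq (x :: rs).
  rewrite /= xNrs map_inj_in_uniq ?iota_uniq // => i j.
  rewrite !mem_iota /= => lt_ip lt_jp /eqP.
  wlog le_ij : i j lt_ip lt_jp / (i <= j)%N => [wl|].
    by have [/wl|/ltnW/wl] := leqP i j; [exact | rewrite eq_sym => wl' /wl' ->].
  by rewrite eq_sym -subr_eq0 -natrB // -(dvdn_pcharf pcharKp) => /dvdn_leq; lia.
have := max_poly_roots nz rs_root rs_uniq.
by rewrite size_polyDl ?size_polyXn ?size_polyN ?size_polyX //= size_map size_iota ltnn.
Qed.

End FrobeniusTrace.

(** The trace is a polynomial of degree [p ^ (m - 1)] in [x], too small to vanish on all [p ^ m]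
    elements. *)
Lemma exists_trace_abs_neq0 (K : finFieldType) (p m : nat) :
  prime p -> #|K| = (p ^ m)%N -> exists x : K, trace_abs p m x != 0.
Proof.
move=> p_pr cardK; have p_gt1 := prime_gt1 p_pr.
case: m cardK => [|m] cardK; first by have := finNzRing_gt1 K; rewrite cardK.
apply/existsP; apply: contraT => /existsPn tr0.
pose P : {poly K} := \sum_(i < m.+1) 'X^(p ^ i).
have sizeP : size P = (p ^ m).+1.
  rewrite /P big_ord_recr /= addrC size_polyDl ?size_polyXn //.
  apply: leq_ltn_trans (size_sum _ _ _) _; rewrite ltnS.
  by apply/bigmax_leqP => i _; rewrite size_polyXn ltn_exp2l.
have nzP : P != 0 by rewrite -size_poly_gt0 sizeP.
have rootP : all (root P) (enum K).
  apply/allP => x _; rewrite rootE /P horner_sum.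
  by have := tr0 x; rewrite negbK; under eq_bigr do rewrite hornerXn.
have := max_poly_roots nzP rootP (enum_uniq K).
by rewrite sizeP -cardE cardK ltnS leqNgt ltn_exp2l // ltnSn.
Qed.

Section AdditiveCharacter.

Variables (K : finFieldType) (p m : nat) (xi : algC).
Hypotheses (p_pr : prime p) (cardK : #|K| = (p ^ m)%N).
Hypothesis xi_prim : p.-primitive_root xi.

Let pcharKp : p \in [pchar K] := card_finPcharP cardK p_pr.

(* The representative [n < p] of an element [n%:R] of the prime subfield. *)
Definition prime_digit (x : K) : nat :=
  if [pick n : 'I_p | x == n%:R] is Some n then val n else 0.

Definition add_char (x : K) : algC := xi ^+ prime_digit (trace_abs p m x).

Lemma trace_digit (x : K) : trace_abs p m x = (prime_digit (trace_abs p m x))%:R.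
Proof.
rewrite /prime_digit; case: pickP => [n /eqP //|no_n].
have [|n xn] := @prime_subfieldP K p pcharKp (trace_abs p m x).
  by apply: trace_abs_fixed => //; rewrite -cardK expf_card.
by have := no_n n; rewrite xn eqxx.
Qed.

Lemma add_charE (x : K) n : trace_abs p m x = n%:R -> add_char x = xi ^+ n.
Proof.
rewrite trace_digit /add_char; set d := prime_digit _ => Edn.
apply/eqP; rewrite (eq_prim_root_expr xi_prim).
wlog le_dn : d n Edn / (d <= n)%N => [wl|].
  have [/(wl _ _ Edn)//|/ltnW le_nd] := leqP d n.
  by rewrite eq_sym; apply: wl.
rewrite eq_sym eqn_mod_dvd // (dvdn_pcharf pcharKp) natrB // Edn subrr //.
Qed.

Lemma add_char0 : add_char 0 = 1.
Proof. by rewrite (@add_charE 0 0) ?trace_abs0 ?expr0. Qed.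

Lemma add_charD (x y : K) : add_char (x + y) = add_char x * add_char y.
Proof.
rewrite -exprD; apply: add_charE.
by rewrite natrD -!trace_digit trace_absD.
Qed.

Lemma add_charMn (x : K) n : add_char (x *+ n) = add_char x ^+ n.
Proof.
elim: n => [|n IHn]; first by rewrite mulr0n add_char0.
by rewrite mulrS add_charD IHn exprS.
Qed.

Lemma add_char_eq1 (x : K) : (add_char x == 1) = (trace_abs p m x == 0).
Proof.
by rewrite -(prim_order_dvd xi_prim) (dvdn_pcharf pcharKp) -trace_digit.
Qed.

Lemma Aint_add_char (x : K) : add_char x \in Aint.
Proof. by rewrite rpredX // (Aint_prim_root xi_prim). Qed.

(** Orthogonality: for [z <> 0], shifting [y] by [x0 / z] multiplies the sum by [add_char x0], which
    differs from 1 when [x0] has nonzero trace. *)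
Lemma sum_add_char (z : K) :
  \sum_y add_char (y * z) = if z == 0 then #|K|%:R else 0.
Proof.
have [->|nz] := eqVneq z 0.
  under eq_bigr do rewrite mulr0 add_char0.
  by rewrite sumr_const.
have [x0 tr_x0] := exists_trace_abs_neq0 p_pr cardK.
set S := \sum_y _; suff: S * (add_char x0 - 1) = 0.
  by move/eqP; rewrite mulf_eq0 subr_eq0 add_char_eq1 (negPf tr_x0) orbF => /eqP.
rewrite mulrBr mulr1 /S; apply/eqP; rewrite subr_eq0; apply/eqP.
rewrite [RHS](reindex_inj (addIr (x0 / z))) mulr_suml; apply: eq_bigr => y _.
by rewrite mulrDl divfK // add_charD.
Qed.

(** A full geometric sum over [s < p], minus its term at [s = 0]. *)
Lemma sum_add_charMn (z : K) :
  \sum_(s < p.-1) add_char (z *+ s.+1) =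
    p%:R * (trace_abs p m z == 0)%:R - 1.
Proof.
have p_gt0 := prime_gt0 p_pr.
have /eqP : \sum_(s < p) add_char (z *+ s) = p%:R * (trace_abs p m z == 0)%:R.
  under eq_bigr do rewrite add_charMn.
  have [tr0|tr_n0] := boolP (trace_abs p m z == 0).
    move: tr0; rewrite -add_char_eq1 => /eqP->; under eq_bigr do rewrite expr1n.
    by rewrite sumr_const card_ord mulr1.
  rewrite mulr0; move: tr_n0; rewrite -add_char_eq1 -subr_eq0 => tr_n0.
  apply/eqP; have /eqP := subrX1 (add_char z) p.
  rewrite -exprM mulnC exprM (prim_expr_order xi_prim) expr1n subrr eq_sym.
  by rewrite mulf_eq0 (negPf tr_n0).
rewrite -(big_mkord xpredT (fun s => add_char (z *+ s))) big_ltn // big_add1.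
by rewrite big_mkord mulr0n add_char0 => /eqP <-; rewrite [RHS]addrC addKr.
Qed.

End AdditiveCharacter.

(** * Cubic classes and zeros of the Fermat cubic form *)

Lemma big_ord_mul (V : nmodType) c d (f : nat -> V) :
  \sum_(i < d * c) f i = \sum_(s < c) \sum_(j < d) f (d * s + j)%N.
Proof.
elim: c => [|c IHc]; first by rewrite muln0 !big_ord0.
by rewrite mulnSr big_split_ord big_ord_recr /= IHc.
Qed.

(** Translation by 1 permutes [K], so it leaves the sum of all elements unchanged. *)
Lemma card_natr0 (K : finFieldType) : (#|K|)%:R = 0 :> K.
Proof.
have : \sum_(x : K) x = \sum_(x : K) (x + 1) by apply: reindex_inj (addIr 1).
by rewrite big_split /= sumr_const -[LHS]addr0 => /addrI.
Qed.

Section CubicClasses.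

Variables (K : finFieldType) (c : nat) (g : K).
Hypotheses (cardK : #|K| = (3 * c).+1) (g_prim : (3 * c).-primitive_root g).

Let c_gt0 : (0 < c)%N.
Proof. by have := prim_order_gt0 g_prim; rewrite muln_gt0. Qed.

Lemma prim_root_neq0 : g != 0.
Proof.
apply/eqP => g0; have := prim_expr_order g_prim.
by rewrite g0 expr0n muln_eq0 /= eqn0Ngt c_gt0 => /esym/eqP; rewrite oner_eq0.
Qed.

Lemma expf_order (x : K) : x != 0 -> x ^+ (3 * c) = 1.
Proof.
by move=> nz_x; apply: (mulfI nz_x); rewrite -exprS -cardK expf_card mulr1.
Qed.

Lemma sum_prim_root (V : nmodType) (f : K -> V) :
  \sum_x f x = f 0 + \sum_(i < 3 * c) f (g ^+ i).
Proof.
rewrite (bigD1 0) //=; congr (_ + _).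
transitivity (\sum_(i in [set: 'I_(3 * c)]) f (g ^+ i)); last first.
  by apply: eq_bigl => i; rewrite inE.
have := big_imset f (h := fun i : 'I_(3 * c) => g ^+ i) (A := setT).
rewrite /= => <-.
  apply: eq_bigl => x; apply/idP/imsetP => [nz_x|[i _ ->]].
    by have [i ->] := prim_rootP g_prim (expf_order nz_x); exists i.
  by rewrite expf_neq0 ?prim_root_neq0.
move=> i j _ _ /eqP; rewrite (eq_prim_root_expr g_prim) => /eqP.
by rewrite !modn_small // => /val_inj.
Qed.

(** Cubing is three-to-one on nonzero elements: the exponents [s], [s + c] and [s + 2 c] give the
    same cube. *)
Lemma sum_cubes (V : nmodType) (f : K -> V) :
  \sum_x f (x ^+ 3) = f 0 + (\sum_(s < c) f (g ^+ (3 * s))) *+ 3.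
Proof.
rewrite sum_prim_root expr0n /=; congr (_ + _).
rewrite [in LHS]mulnC (@big_ord_mul _ 3 c (fun i => f ((g ^+ i) ^+ 3))).
transitivity (\sum_(j < 3) \sum_(s < c) f (g ^+ (3 * s))).
  apply: eq_bigr => j _; apply: eq_bigr => s _; congr f.
  rewrite -exprM mulnDl exprD mulnAC -(mulnC 3 c) exprM (prim_expr_order g_prim).
  by rewrite expr1n mul1r mulnC.
by rewrite sumr_const card_ord.
Qed.

Lemma sum_cubic_classes (V : nmodType) (f : K -> V) :
  (forall y, f (y * g ^+ 3) = f y) ->
  \sum_y f y = f 0 + (f 1 + f g + f (g ^+ 2)) *+ c.
Proof.
move=> f_cube; rewrite sum_prim_root; congr (_ + _).
rewrite (big_ord_mul _ _ (fun i => f (g ^+ i))).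
have f_cubes y s : f (g ^+ (3 * s) * y) = f y.
  elim: s => [|s IHs]; first by rewrite muln0 expr0 mul1r.
  by rewrite mulnS exprD -mulrA mulrC f_cube.
transitivity (\sum_(s < c) (f 1 + f g + f (g ^+ 2))).
  apply: eq_bigr => s _; rewrite !big_ord_recl big_ord0 addr0 addrA.
  by rewrite !(exprD _ (3 * s)) !f_cubes.
by rewrite sumr_const card_ord.
Qed.

Lemma cubeP (x : K) : x ^+ c = 1 -> exists y, x = y ^+ 3.
Proof.
move=> xc; have [|i xi] := prim_rootP g_prim (x := x).
  by rewrite mulnC exprM xc expr1n.
have : (3 * c %| i * c)%N by rewrite (prim_order_dvd g_prim) exprM -xi xc.
rewrite dvdn_pmul2r // => /dvdnP[j ij].
by exists (g ^+ j); rewrite -exprM -ij.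
Qed.

(** The substitution of [g x] for [x] multiplies the sum by [g ^ n], which is not 1. *)
Lemma sum_expr_eq0 n : ~~ (3 * c %| n)%N -> \sum_(x : K) x ^+ n = 0.
Proof.
rewrite (prim_order_dvd g_prim) -subr_eq0 => nz.
apply: (mulfI nz); rewrite mulr0 mulrBl mul1r mulr_sumr; apply/eqP.
rewrite subr_eq0 eq_sym (reindex_inj (mulfI prim_root_neq0)).
by apply/eqP/eq_bigr => x _; rewrite exprMn.
Qed.

Lemma sum_expr_order : \sum_(x : K) x ^+ (3 * c) = -1.
Proof.
apply/eqP; rewrite -subr_eq0 opprK -[X in _ == X](card_natr0 K) (bigD1 0) //=.
rewrite expr0n muln_eq0 /= eqn0Ngt c_gt0 add0r.
under eq_bigr => x nz_x do rewrite expf_order //.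
by rewrite sumr_const cardC1 natr1 cardK.
Qed.

End CubicClasses.

Lemma modn3_exp p n : (p %% 3 = 1 -> p ^ n %% 3 = 1)%N.
Proof. by move=> p1; rewrite -modnXm p1 exp1n. Qed.

Lemma fact_triple c :
  ((3 * c)`! = 'C(3 * c, 2 * c) * 'C(2 * c, c) * c`! ^ 3)%N.
Proof.
have le_2c : (2 * c <= 3 * c)%N by rewrite leq_mul2r orbT.
have le_c : (c <= 2 * c)%N by rewrite leq_pmull.
have sub2 : (3 * c - 2 * c = c)%N by rewrite -mulnBl mul1n.
have sub1 : (2 * c - c = c)%N by rewrite -{2}[c]mul1n -mulnBl mul1n.
by rewrite -(bin_fact le_2c) -(bin_fact le_c) sub2 sub1 !expnS expn0 muln1 !mulnA.
Qed.

Lemma logn_fact_widen p n k : prime p -> (n <= k)%N ->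
  logn p n`! = (\sum_(1 <= i < k.+1) n %/ p ^ i)%N.
Proof.
move=> p_pr le_nk; rewrite logn_fact // [RHS](@big_cat_nat _ _ _ n.+1) //=.
rewrite [X in (_ = _ + X)%N]big_nat_cond [X in (_ = _ + X)%N]big1 ?addn0 // => i.
rewrite andbT => /andP[lt_ni _]; rewrite divn_small //.
by apply: ltn_trans lt_ni _; apply: ltn_expl; apply: prime_gt1.
Qed.

(* In base [p] all digits of [c = (p ^ m - 1) / 3] are [(p - 1) / 3], so adding
   three copies of [c] produces no carry. *)
Lemma coprime_trinomial p m c :
  prime p -> (p %% 3 = 1 -> p ^ m = (3 * c).+1 ->
    ~~ (p %| 'C(3 * c, 2 * c) * 'C(2 * c, c)))%N.
Proof.
move=> p_pr p1 Ec; have p_gt1 := prime_gt1 p_pr.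
have E : (logn p (3 * c)`! = 3 * logn p c`!)%N.
  rewrite logn_fact // (@logn_fact_widen p c (3 * c)) //; last lia.
  rewrite big_distrr /=; apply: eq_big_nat => i /andP[i_gt0 _].
  have [le_mi|lt_im] := leqP m i.
    have lt_i : (p ^ m <= p ^ i)%N by rewrite leq_exp2l.
    rewrite Ec in lt_i.
    by rewrite !divn_small ?muln0 //; apply: leq_ltn_trans lt_i; rewrite leq_pmull.
  have Ee := divn_eq (p ^ i) 3; rewrite modn3_exp // in Ee.
  have Ef := divn_eq (p ^ (m - i)) 3; rewrite modn3_exp // in Ef.
  move: Ee Ef; set e := (p ^ i %/ 3)%N; set f := (p ^ (m - i) %/ 3)%N => Ee Ef.
  have := expnD p (m - i) i; rewrite subnK ?(ltnW lt_im) // Ec Ef Ee => Efe.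
  (* From [3 c + 1 = (3 f + 1) (3 e + 1)] with [p ^ i = 3 e + 1]: the quotients of [c] and [3 c] by
     [p ^ i] are [f] and [3 f], so the Legendre sums agree term by term. *)
  have -> : (c = f * (e * 3 + 1) + e)%N by nia.
  rewrite mulnDr mulnA !divnMDl ?addn1 // !divn_small; lia.
move: E; rewrite fact_triple lognM ?lognX ?muln_gt0 ?expn_gt0 ?fact_gt0 ?bin_gt0 //; try lia.
by rewrite -[X in _ = X -> _]add0n => /addIn log0;
  rewrite -[X in (X %| _)%N]expn1 pfactor_dvdn ?log0 // muln_gt0 !bin_gt0; lia.
Qed.

Section CubicZeros.

Variables (K : finFieldType) (c : nat) (g : K).
Hypotheses (cardK : #|K| = (3 * c).+1) (g_prim : (3 * c).-primitive_root g).

Definition cubic_zeros : nat :=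
  (\sum_(x : K) \sum_(y : K) \sum_(z : K) (x ^+ 3 + y ^+ 3 + z ^+ 3 == 0)%R)%N.

Let c_gt0 : (0 < c)%N.
Proof. by have := prim_order_gt0 g_prim; rewrite muln_gt0. Qed.

Let P n : K := \sum_(x : K) x ^+ n.

(** At [k = 0] the convention [0 ^ 0 = 1] turns the power sum into [#|K|], which is zero in [K]. *)
Let P_eq0 k : P (3 * k) != 0 -> (c %| k)%N && (0 < k)%N.
Proof.
apply: contraNT; rewrite negb_and -eqn0Ngt => /orP[ndv|/eqP->].
  by rewrite /P (sum_expr_eq0 g_prim) ?eqxx // dvdn_pmul2l.
by rewrite /P muln0; under eq_bigr do rewrite expr0; rewrite sumr_const card_natr0.
Qed.

(* Among [i + j + k = 3 c] only [i = j = k = c] contributes. *)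
Let P_triple i j k : (i + j + k = 3 * c)%N -> ~~ ((j == c) && (k == c)) ->
  P (3 * i) * P (3 * j) * P (3 * k) = 0.
Proof.
move=> Es; apply: contraNeq; rewrite !mulf_eq0 !negb_or.
case/andP=> [/andP[/P_eq0/andP[/dvdnP[i' Ei] i0] /P_eq0/andP[/dvdnP[j' Ej] j0]]].
case/P_eq0/andP=> /dvdnP[k' Ek] k0; subst i j k.
move: i0 j0 k0 Es; rewrite !muln_gt0 c_gt0 -!mulnDl !andbT => i0 j0 k0 /eqP.
rewrite eqn_pmul2r // => /eqP Es.
have -> : j' = 1%N by lia.
by have -> : k' = 1%N by [lia]; rewrite mul1n eqxx.
Qed.

(** Two binomial expansions separate the variables into products of power sums; the only surviving
    product is the cube of [P (3 * c) = -1]. *)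
Lemma sum_cubic_form_expr :
  \sum_(x : K) \sum_(y : K) \sum_(z : K) (x ^+ 3 + y ^+ 3 + z ^+ 3) ^+ (3 * c) =
  - ('C(3 * c, 2 * c) * 'C(2 * c, c))%:R.
Proof.
transitivity (\sum_(i < (3 * c).+1) \sum_(j < i.+1)
    (P (3 * (3 * c - i)) * P (3 * (i - j)) * P (3 * j)) *+ 'C(3 * c, i) *+ 'C(i, j)).
  transitivity (\sum_(x : K) \sum_(y : K) \sum_(z : K)
    \sum_(i < (3 * c).+1) \sum_(j < i.+1)
      (x ^+ (3 * (3 * c - i)) * y ^+ (3 * (i - j)) * z ^+ (3 * j))
        *+ 'C(3 * c, i) *+ 'C(i, j)).
    apply: eq_bigr => x _; apply: eq_bigr => y _; apply: eq_bigr => z _.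
    rewrite -addrA exprDn; apply: eq_bigr => i _.
    rewrite exprDn mulr_sumr -sumrMnl; apply: eq_bigr => j _.
    by rewrite -!exprM mulrnAr mulrA mulrnAC.
  pose U i j x y z : K := (x ^+ (3 * (3 * c - i)) * y ^+ (3 * (i - j)) * z ^+ (3 * j))
        *+ 'C(3 * c, i) *+ 'C(i, j).
  transitivity (\sum_(i < (3 * c).+1) \sum_(j < i.+1)
      \sum_(x : K) \sum_(y : K) \sum_(z : K) U i j x y z).
    (* The sums over [z], [y] and [x] are moved inside those over [i] and [j] one at a time,
       innermost first. *)
    under eq_bigr => x _.
      under eq_bigr => y _.
        rewrite exchange_big /=; under eq_bigr do rewrite exchange_big /=; over.
      rewrite exchange_big /=; under eq_bigr do rewrite exchange_big /=; over.
    by rewrite exchange_big /=; under eq_bigr do rewrite exchange_big /=.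
  apply: eq_bigr => i _; apply: eq_bigr => j _; rewrite /U /P.
  rewrite -mulrA mulr_suml -!sumrMnl; apply: eq_bigr => x _.
  rewrite mulr_suml mulr_sumr -!sumrMnl; apply: eq_bigr => y _.
  by rewrite !mulr_sumr -!sumrMnl; apply: eq_bigr => z _; rewrite !mulrA.
have lt_2c : (2 * c < (3 * c).+1)%N by lia.
have lt_c : (c < (2 * c).+1)%N by lia.
rewrite (bigD1 (Ordinal lt_2c)) //= (bigD1 (Ordinal lt_c)) //=.
rewrite [X in _ + X + _]big1 ?addr0 => [|j /eqP/val_eqP /= nj].
  rewrite [X in _ + X]big1 ?addr0 => [|i /eqP/val_eqP /= ni].
    have -> : (3 * c - 2 * c = c)%N by lia.
    have -> : (2 * c - c = c)%N by lia.
    rewrite /P (sum_expr_order cardK g_prim) -mulrnA.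
    by rewrite mulrNN !mulr1 mul1r mulNrn.
  apply: big1 => j _; rewrite P_triple ?mul0rn //; have := ltn_ord i; have := ltn_ord j.
    lia.
  by move=> ? ?; apply/negP; move: ni; lia.
rewrite P_triple ?mul0rn //; have := ltn_ord j; first lia.
by move=> ?; rewrite (negPf nj) andbF.
Qed.

(** As in Chevalley-Warning, [1 - v ^ (q - 1)] is the indicator of [v = 0]; its constant term sums
    to a multiple of [#|K|], hence to zero. *)
Lemma cubic_zeros_natr :
  cubic_zeros%:R = ('C(3 * c, 2 * c) * 'C(2 * c, c))%:R :> K.
Proof.
have ind (x : K) : (x == 0)%:R = 1 - x ^+ (3 * c).
  have [->|nz] := eqVneq x 0; last by rewrite (expf_order cardK nz) subrr.
  by rewrite expr0n muln_eq0 /= eqn0Ngt c_gt0 subr0.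
rewrite /cubic_zeros natr_sum.
under eq_bigr => x _.
  rewrite natr_sum; under eq_bigr => y _.
    rewrite natr_sum; under eq_bigr do rewrite ind.
    rewrite sumrB sumr_const card_natr0 sub0r; over.
  rewrite sumrN; over.
by rewrite sumrN sum_cubic_form_expr opprK.
Qed.

End CubicZeros.

(** * Cubic exponential sums *)

(** The function [N] of the introduction: for a generator [g], the powers [g ^ (3 s)] with [s < c]
    list the nonzero cubes. *)
Definition cubic_weight (K : finFieldType) (p m c : nat) (g y : K) : nat :=
  #|[set s : 'I_c | trace_abs p m (y * g ^+ (3 * s)) != 0]|.

Section CubicSums.

Variables (K : finFieldType) (p t c : nat) (g : K) (xi : algC).
Hypotheses (p_pr : prime p) (p_mod3 : (p %% 3 = 1)%N).
Hypotheses (cardKp : #|K| = (p ^ (3 * t))%N) (cardK : #|K| = (3 * c).+1).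
Hypotheses (g_prim : (3 * c).-primitive_root g) (xi_prim : p.-primitive_root xi).

Let pcharKp : p \in [pchar K] := card_finPcharP cardKp p_pr.
Local Notation psi := (@add_char K p (3 * t) xi).
Let q : nat := #|K|.

Let psiD := add_charD p_pr cardKp xi_prim.
Let psi0 := add_char0 p_pr cardKp xi_prim.

Definition cubic_sum (y : K) : algC := \sum_(x : K) psi (y * x ^+ 3).

(** The cubic Gauss period: each nonzero cube is counted once. *)
Definition cubic_period (y : K) : algC := \sum_(s < c) psi (y * g ^+ (3 * s)).

Lemma cubic_sum_cubeM (y u : K) : u != 0 -> cubic_sum (y * u ^+ 3) = cubic_sum y.
Proof.
move=> nz_u; rewrite /cubic_sum [RHS](reindex_inj (mulfI nz_u)).
by apply: eq_bigr => x _; rewrite exprMn -(mulrA y (u ^+ 3)).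
Qed.

Lemma cubic_sum0 : cubic_sum 0 = q%:R.
Proof.
rewrite /cubic_sum; under eq_bigr do rewrite mul0r psi0.
by rewrite sumr_const.
Qed.

Lemma cubic_sum_period (y : K) : cubic_sum y = 1 + 3 * cubic_period y.
Proof.
rewrite /cubic_sum (sum_cubes cardK g_prim (fun x => psi (y * x))).
by rewrite mulr0 psi0 mulr_natl.
Qed.

(** This is what makes the prime field consist of cubes. With [P = p ^ t = 3 e + 1], [3 c = P ^ 3 -
    1 = (P - 1) (P ^ 2 + P + 1)], and the last factor is [3 (3 e ^ 2 + 3 e + 1)]. *)
Lemma dvdn_pred_cubic_order : (p.-1 %| c)%N.
Proof.
have [e Ee] : exists e, (p ^ t = e * 3 + 1)%N.
  by exists (p ^ t %/ 3)%N; rewrite {1}(divn_eq (p ^ t) 3) modn3_exp.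
have Ec : (c = (p ^ t).-1 * (3 * e ^ 2 + 3 * e + 1))%N.
  have := cardKp; rewrite cardK (mulnC 3 t) expnM Ee addn1 /=; nia.
by rewrite Ec predn_exp dvdn_mulr // dvdn_mulr.
Qed.

Lemma natr_cube s : (s < p.-1)%N -> exists2 u : K, u != 0 & s.+1%:R = u ^+ 3.
Proof.
move=> lt_s; have p_gt1 := prime_gt1 p_pr.
have nz : s.+1%:R != 0 :> K.
  by rewrite -(dvdn_pcharf pcharKp) gtnNdvd // -[p]prednK // ltnW.
have [|u Eu] := cubeP g_prim (x := s.+1%:R).
  have /dvdnP[d ->] := dvdn_pred_cubic_order.
  rewrite mulnC exprM (_ : _ ^+ p.-1 = 1) ?expr1n //.
  apply: (mulfI nz); rewrite -exprS prednK ?(ltnW p_gt1) // mulr1.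
  by rewrite -(pFrobenius_autE pcharKp) pFrobenius_aut_nat.
by exists u => //; apply: contraNneq nz => u0; rewrite Eu u0 expr0n.
Qed.

Lemma card_cubic_weight (y : K) :
  \sum_(x : K) (trace_abs p (3 * t) (y * x ^+ 3) == 0)%:R =
    q%:R - 3 * (cubic_weight p (3 * t) c g y)%:R :> algC.
Proof.
rewrite (sum_cubes cardK g_prim (fun x => (trace_abs p (3 * t) (y * x) == 0)%:R)).
have -> : \sum_(s < c) (trace_abs p (3 * t) (y * g ^+ (3 * s)) == 0)%:R =
    c%:R - (cubic_weight p (3 * t) c g y)%:R :> algC.
  apply/eqP; rewrite eq_sym subr_eq /cubic_weight -sum1_card natr_sum.
  rewrite [X in _ + X]big_mkcond /= -big_split /= -[X in X%:R == _](card_ord c).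
  rewrite -(sumr_const 'I_c (1 : algC)); apply/eqP/eq_bigr => s _.
  by rewrite inE; case: eqP; rewrite ?addr0 ?add0r.
rewrite mulr0 trace_abs0 // eqxx /q cardK -natr1 natrM /=; ring.
Qed.

(* Every nonzero element of the prime subfield is a cube, so [cubic_sum] is
   invariant under it; summing over the prime subfield makes the trace condition
   appear. *)
Lemma cubic_sum_weight (y : K) :
  3 * p%:R * (cubic_weight p (3 * t) c g y)%:R = p.-1%:R * (q%:R - cubic_sum y).
Proof.
have p_gt0 := prime_gt0 p_pr.
have E : p.-1%:R * cubic_sum y =
    \sum_x (p%:R * (trace_abs p (3 * t) (y * x ^+ 3) == 0)%:R - 1).
  transitivity (\sum_(s < p.-1) cubic_sum (y * s.+1%:R)).
    rewrite -[p.-1 in LHS]card_ord mulr_natl -sumr_const; apply: eq_bigr => s _.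
    by have [u nz_u ->] := natr_cube (ltn_ord s); rewrite cubic_sum_cubeM.
  rewrite exchange_big; apply: eq_bigr => x _ /=.
  rewrite -(sum_add_charMn p_pr cardKp xi_prim); apply: eq_bigr => s _.
  by rewrite mulr_natr mulrnAl.
have Ep : p.-1%:R = p%:R - 1 :> algC by rewrite -[in RHS](prednK p_gt0) -natr1 addrK.
rewrite mulrBr E sumrB sumr_const -mulr_sumr card_cubic_weight -/q Ep; ring.
Qed.

(** The period is an algebraic integer as a sum of roots of unity, and rational because
    [cubic_sum_weight] expresses it through a weight. *)
Lemma cubic_period_int (y : K) : exists e : int, cubic_period y = e%:~R.
Proof.
have p_gt1 := prime_gt1 p_pr.
suff /intrP : cubic_period y \in Num.int by [].
apply: Cint_rat_Aint; last first.
  by apply: rpred_sum => s _; apply: Aint_add_char xi_prim _.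
have nzp : p.-1%:R != 0 :> algC by rewrite pnatr_eq0 -lt0n -ltnS prednK // ltnW.
have -> : cubic_period y =
    (q%:R - 1 - 3 * p%:R * (cubic_weight p (3 * t) c g y)%:R / p.-1%:R) / 3.
  by rewrite cubic_sum_weight cubic_sum_period; field.
by rewrite !(rpredM, rpredB, rpred_nat, rpredV, rpred1).
Qed.

Lemma sum_cubic_sum : \sum_y cubic_sum y = q%:R.
Proof.
rewrite exchange_big (bigD1 0) //= [X in _ + X]big1 ?addr0 => [|x nz_x].
  by rewrite (sum_add_char p_pr cardKp xi_prim) expr0n eqxx.
by rewrite (sum_add_char p_pr cardKp xi_prim) expf_eq0 (negPf nz_x).
Qed.

(** By orthogonality the second moment counts zeros of [x ^ 3 + z ^ 3]: the origin, and after a sign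
    change in [z], nine pairs for each of the [c] nonzero cubes. *)
Lemma sum_cubic_sum_sq : \sum_y cubic_sum y ^+ 2 = q%:R * (1 + 9 * c%:R).
Proof.
have -> : \sum_y cubic_sum y ^+ 2 =
    q%:R * \sum_(x : K) \sum_(z : K) (x ^+ 3 + z ^+ 3 == 0)%:R.
  under eq_bigr => y _.
    rewrite expr2 [X in X * _]/cubic_sum mulr_suml.
    under eq_bigr do rewrite mulr_sumr; over.
  rewrite exchange_big mulr_sumr; apply: eq_bigr => x _ /=.
  rewrite exchange_big mulr_sumr; apply: eq_bigr => z _ /=.
  under eq_bigr do rewrite -psiD -mulrDr.
  by rewrite (sum_add_char p_pr cardKp xi_prim); case: eqP; rewrite ?mulr1 ?mulr0.
congr (_ * _).
have cubes_neq s : g ^+ (3 * s) != 0 by rewrite expf_neq0 // (prim_root_neq0 g_prim).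
under eq_bigr => x _.
  rewrite (reindex_inj (inv_inj (@opprK K))) /=.
  under eq_bigr do rewrite exprNn -signr_odd /= expr1 mulN1r subr_eq0.
  rewrite (sum_cubes cardK g_prim (fun z => (x ^+ 3 == z)%:R)) expf_eq0 /=; over.
rewrite big_split /= sumrMnl exchange_big /=; congr (_ + _).
  rewrite (bigD1 0) //= eqxx big1 ?addr0 // => x nz_x.
  by rewrite (negPf nz_x).
have one (s : 'I_c) : \sum_(x : K) (x ^+ 3 == g ^+ (3 * nat_of_ord s))%:R = 3 :> algC.
  rewrite (sum_cubes cardK g_prim (fun z => (z == g ^+ (3 * s))%:R)).
  rewrite eq_sym (negPf (cubes_neq _)) add0r (bigD1 s) //= eqxx big1 ?addr0 // => j nj.
  rewrite (eq_prim_root_expr g_prim) !modn_small ?ltn_mul2l //= eqn_mul2l /=.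
  by rewrite val_eqE (negPf nj).
under eq_bigr do rewrite one.
by rewrite sumr_const card_ord -!mulrnA -!natrM; congr _%:R; clear; lia.
Qed.

Lemma sum_cubic_sum_cube :
  \sum_y cubic_sum y ^+ 3 = q%:R * (cubic_zeros K)%:R.
Proof.
rewrite /cubic_zeros natr_sum.
transitivity (\sum_y \sum_(x : K) \sum_(z : K) \sum_(w : K)
    psi (y * x ^+ 3) * (psi (y * z ^+ 3) * psi (y * w ^+ 3))).
  apply: eq_bigr => y _; rewrite /cubic_sum exprS expr2 mulr_suml.
  apply: eq_bigr => x _; rewrite mulr_suml mulr_sumr.
  by apply: eq_bigr => z _; rewrite !mulr_sumr.
rewrite exchange_big mulr_sumr; apply: eq_bigr => x _ /=.
rewrite exchange_big natr_sum mulr_sumr; apply: eq_bigr => y _ /=.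
rewrite exchange_big natr_sum mulr_sumr; apply: eq_bigr => z _ /=.
under eq_bigr do rewrite -!psiD -!mulrDr addrA.
by rewrite (sum_add_char p_pr cardKp xi_prim); case: eqP; rewrite ?mulr1 ?mulr0.
Qed.

Lemma sum_cubic_sum_classes n :
  \sum_y cubic_sum y ^+ n =
    q%:R ^+ n + (cubic_sum 1 ^+ n + cubic_sum g ^+ n + cubic_sum (g ^+ 2) ^+ n) *+ c.
Proof.
rewrite (sum_cubic_classes cardK g_prim) ?cubic_sum0 // => y.
by rewrite cubic_sum_cubeM ?(prim_root_neq0 g_prim).
Qed.

End CubicSums.

(** * Integer arithmetic of [4 p ^ t = a ^ 2 + 27 b ^ 2] *)

Section CubicArithmetic.

Variables (p t : nat).
Hypotheses (p_pr : prime p) (p_mod3 : (p %% 3 = 1)%N).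

Let P : int := p%:Z ^+ t.

Let prime_dvdzM (x y : int) : (p%:Z %| x * y)%Z = (p%:Z %| x)%Z || (p%:Z %| y)%Z.
Proof. by rewrite !dvdzE abszM /= Euclid_dvdM. Qed.

Let p_ge7 : (7 <= p)%N.
Proof.
have p_gt1 := prime_gt1 p_pr; have := p_mod3.
rewrite leqNgt; apply: contra_eqN; move: p_pr.
by case: (p) p_gt1 => [|[|[|[|[|[|[|n]]]]]]].
Qed.

Let prime_Ndvdz (n : nat) : (0 < n < 7)%N -> (p%:Z %| n%:Z)%Z = false.
Proof.
by case/andP=> n_gt0 n_lt; rewrite dvdzE /= gtnNdvd // (leq_trans n_lt).
Qed.

Lemma prime_Ndvdz27 : (p%:Z %| 27)%Z = false.
Proof.
by rewrite dvdzE /= -[27%N]/(3 ^ 3)%N Euclid_dvdX // andbT gtnNdvd // (leq_trans _ p_ge7).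
Qed.

Lemma coprimez_prime_pow (x : int) : ~~ (p %| x)%Z -> coprimez P x.
Proof. by rewrite dvdzE => px; rewrite coprimezE abszX coprimeXl // prime_coprime. Qed.

(** By Brahmagupta's identity [(a a' + 27 b b') ^ 2 + 27 (a b' - a' b) ^ 2 = 16 P ^ 2]; if the
    second difference is [x P], then [27 x ^ 2 <= 16] and [x = 0]. *)
Lemma repr27_dvd_eq0 (a b a' b' : int) :
  4 * P = a ^+ 2 + 27 * b ^+ 2 -> 4 * P = a' ^+ 2 + 27 * b' ^+ 2 ->
  (P %| a * b' - a' * b)%Z -> a * b' = a' * b.
Proof.
move=> Ea Ea' /dvdzP[x Ex].
have P_gt0 : 0 < P by rewrite exprn_gt0 // ltz_nat prime_gt0.
have E16 : (a * a' + 27 * b * b') ^+ 2 + P ^+ 2 * (27 * x ^+ 2) = P ^+ 2 * 16.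
  transitivity ((4 * P) * (4 * P)); last by ring.
  rewrite {1}Ea Ea' (_ : P ^+ 2 * _ = 27 * (a * b' - a' * b) ^+ 2); last first.
    by rewrite Ex; ring.
  ring.
have : P ^+ 2 * (27 * x ^+ 2) <= P ^+ 2 * 16 by rewrite -E16 lerDr sqr_ge0.
rewrite (ler_pM2l (exprn_gt0 2 P_gt0)) => le16.
have x0 : x = 0.
  by apply/eqP; rewrite -sqrf_eq0; move: le16 (sqr_ge0 x); clear; lia.
by apply/eqP; rewrite -subr_eq0 Ex x0 mul0r.
Qed.

(** [P] divides [(a b' - a' b) (a b' + a' b)]. Since [p] cannot divide both factors, whose sum is
    [2 a b'], all of [P] divides one of them, and [repr27_dvd_eq0] applies to [b'] or [- b']. The
    residue modulo 3 fixes the sign of [a']. *)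
Lemma repr27_unique (a b a' b' : int) : (0 < t)%N ->
  4 * P = a ^+ 2 + 27 * b ^+ 2 -> 4 * P = a' ^+ 2 + 27 * b' ^+ 2 ->
  (a %% 3)%Z = 1 -> (a' %% 3)%Z = 1 -> ~~ (p %| a)%Z -> ~~ (p %| a')%Z ->
  a' = a /\ (b' = b \/ b' = - b).
Proof.
move=> t_gt0 Ea Ea' a1 a1' pa pa'.
have pP : (p %| P)%Z by rewrite /P -(prednK t_gt0) exprS dvdz_mulr.
have coP27 : coprimez P 27 by rewrite coprimez_prime_pow ?prime_Ndvdz27.
have key : (a * b' - a' * b) * (a * b' + a' * b) * 27 = P * (4 * (a ^+ 2 - a' ^+ 2)).
  rewrite (_ : P * _ = (4 * P) * a ^+ 2 - (4 * P) * a' ^+ 2); last by ring.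
  by rewrite {1}Ea' Ea; ring.
have pb' : ~~ (p %| b')%Z.
  apply: contra pa' => pb'; have : (p %| a' ^+ 2)%Z.
    rewrite (_ : a' ^+ 2 = 4 * P - 27 * b' * b'); last by rewrite Ea'; ring.
    by rewrite rpredB // ?dvdz_mull // dvdz_mulr.
  by rewrite expr2 prime_dvdzM orbb.
have done b1 : 4 * P = a' ^+ 2 + 27 * b1 ^+ 2 -> (P %| a * b1 - a' * b)%Z ->
    a' = a /\ b1 = b.
  move=> Eb1 /(repr27_dvd_eq0 Ea Eb1) Eab.
  have P_neq0 : 4 * P != 0.
    by rewrite mulf_neq0 // expf_neq0 // eqz_nat -lt0n prime_gt0.
  have Eaa : a ^+ 2 = a' ^+ 2.
    apply: (mulfI P_neq0); apply/eqP; rewrite -subr_eq0; apply/eqP.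
    transitivity (27 * ((a * b1) ^+ 2 - (a' * b) ^+ 2)); last by rewrite Eab; ring.
    by rewrite {1}Eb1 Ea; ring.
  have Ea'a : a' = a.
    move/eqP: Eaa; rewrite eqf_sqr => /orP[/eqP-> //|/eqP].
    by move: a1 a1'; clear; lia.
  split=> //; rewrite Ea'a in Eab; apply: mulfI Eab.
  by apply: contraNneq pa => ->; rewrite dvdz0.
have [pY|pY] := boolP (p %| a * b' + a' * b)%Z; last first.
  have [|-> ->] := done b' Ea'; last by split; [|left].
  by rewrite -(Gauss_dvdzl _ (coprimez_prime_pow pY)) -(Gauss_dvdzl _ coP27) key dvdz_mulr.
have pX : ~~ (p %| a * b' - a' * b)%Z.
  apply/negP => pX; have : (p %| (a * b' - a' * b) + (a * b' + a' * b))%Z.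
    exact: rpredD.
  rewrite (_ : _ - _ + _ = 2%:R * (a * b')); last by ring.
  by rewrite natz !prime_dvdzM prime_Ndvdz // (negPf pa) (negPf pb').
have [||-> Eb] := done (- b'); first by rewrite sqrrN.
  rewrite mulrN -opprD rpredN -(Gauss_dvdzr _ (coprimez_prime_pow pX)).
  by rewrite -(Gauss_dvdzl _ coP27) key dvdz_mulr.
by split=> //; right; rewrite -Eb opprK.
Qed.

(** The [G_i] are the roots of [X ^ 3 - 3 q X - W], where [W] is their product. The third moment
    gives [W = q (q ^ 2 + W - M)], so [q = P ^ 3] divides each [G_i ^ 3], and the product of the
    quotients is [q ^ 2 + W - M], congruent to [- M] modulo [p]. *)
Lemma cubic_sums_divide (q c M : nat) (G0 G1 G2 : int) :
  (0 < t)%N -> q = (p ^ (3 * t))%N -> q = (3 * c).+1 -> ~~ (p %| M)%N ->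
  G0 + G1 + G2 = 0 -> G0 ^+ 2 + G1 ^+ 2 + G2 ^+ 2 = 6 * q%:Z ->
  q%:Z ^+ 3 + (G0 ^+ 3 + G1 ^+ 3 + G2 ^+ 3) *+ c = q%:Z * M%:Z ->
  exists u0 u1 u2 : int,
    [/\ G0 = P * u0, G1 = P * u1, G2 = P * u2 & ~~ (p %| u0 * u1 * u2)%Z].
Proof.
move=> t_gt0 Eq Ec pM s1 s2 s3.
have EqP : q%:Z = P ^+ 3.
  by rewrite Eq /P -exprM (mulnC t) -natz natrX natz.
have P_neq0 : P != 0 by rewrite expf_neq0 // eqz_nat -lt0n prime_gt0.
have pP : (p %| P)%Z by rewrite /P -(prednK t_gt0) exprS dvdz_mulr.
set W := G0 * G1 * G2.
have E2 : G2 = - (G0 + G1) by move: s1; clear; lia.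
have EW : W = q%:Z * (q%:Z ^+ 2 + W - M%:Z).
  have Ec' : q%:Z = 3 * c%:Z + 1 by move: Ec; clear; lia.
  have s3' : G0 ^+ 3 + G1 ^+ 3 + G2 ^+ 3 = 3 * W by rewrite /W E2; ring.
  rewrite s3' in s3.
  transitivity (q%:Z ^+ 3 + q%:Z * W - q%:Z * M%:Z); last by ring.
  by rewrite -s3 Ec'; ring.
have dvd_cube G : G ^+ 3 = 3 * q%:Z * G + W -> exists u, G = P * u.
  move=> EG; have : (P ^+ 3 %| G ^+ 3)%Z.
    rewrite EG EW -EqP; apply: rpredD; last exact: dvdz_mulr.
    by rewrite dvdz_mulr // dvdz_mull.
  rewrite dvdzE !abszX dvdn_pexp2r // => PG; have : (P %| G)%Z by rewrite dvdzE abszX.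
  by case/dvdzP=> u ->; exists u; rewrite mulrC.
have Eq6 : 3 * q%:Z = G0 ^+ 2 + G0 * G1 + G1 ^+ 2 by rewrite E2 in s2; move: s2; clear; lia.
have [|u0 E0] := dvd_cube G0; first by rewrite Eq6 /W E2; ring.
have [|u1 E1] := dvd_cube G1; first by rewrite Eq6 /W E2; ring.
have [|u2 E2'] := dvd_cube G2; first by rewrite Eq6 /W E2; ring.
exists u0, u1, u2; split=> //.
have -> : u0 * u1 * u2 = q%:Z ^+ 2 + W - M%:Z.
  apply: (mulfI (expf_neq0 3 P_neq0)).
  by rewrite -EqP -EW /W E0 E1 E2' EqP; ring.
rewrite rpredBl; first by rewrite dvdzE.
have pq : (p %| q%:Z)%Z by rewrite EqP exprS dvdz_mulr.
by rewrite rpredD //; [rewrite expr2 | rewrite EW]; rewrite dvdz_mulr.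
Qed.

(** If two of the values differ by [9 d] and [x] is the third, the sums of values and of squares
    give [4 P = x ^ 2 + 27 d ^ 2]; uniqueness then yields [x = a] and [d = b] or [d = - b]. *)
Lemma repr27_perm (a b u0 u1 u2 : int) : (0 < t)%N ->
  4 * P = a ^+ 2 + 27 * b ^+ 2 -> (a %% 3)%Z = 1 -> ~~ (p %| a)%Z ->
  (u0 %% 3)%Z = 1 -> (u1 %% 3)%Z = 1 -> (u2 %% 3)%Z = 1 ->
  u0 + u1 + u2 = 0 -> u0 ^+ 2 + u1 ^+ 2 + u2 ^+ 2 = 6 * P ->
  ~~ (p %| u0 * u1 * u2)%Z ->
  exists v2 v3 : int, [/\ 2 * v2 = - (a + 9 * b), 2 * v3 = - (a - 9 * b)
    & perm_eq [:: u0; u1; u2] [:: a; v2; v3]].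
Proof.
move=> t_gt0 Ea a1 pa.
have mod9 (x y z : int) : (9 %| y - z)%Z ->
    (x %% 3)%Z = 1 -> x + y + z = 0 -> x ^+ 2 + y ^+ 2 + z ^+ 2 = 6 * P ->
    ~~ (p %| x)%Z ->
    exists v2 v3 : int, [/\ 2 * v2 = - (a + 9 * b), 2 * v3 = - (a - 9 * b)
      & perm_eq [:: x; y; z] [:: a; v2; v3]].
  case/dvdzP=> d Ed x1 s1 s2 px.
  have Ex : 4 * P = x ^+ 2 + 27 * d ^+ 2.
    have Ez : z = - (x + y) by move: s1; clear; lia.
    have Ex : x = d * 9 - 2 * y by move: Ed s1; clear; lia.
    by rewrite Ez Ex in s2; rewrite Ex; move: s2; clear; lia.
  have [Exa [Eb|Eb]] := repr27_unique t_gt0 Ea Ex a1 x1 pa px; subst x d.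
    exists z, y; split; [move: Ed s1; clear; lia..|].
    by rewrite perm_cons (perm_catC [:: y] [:: z]).
  exists y, z; split=> //; move: Ed s1; clear; lia.
move=> u01 u11 u21 s1 s2; rewrite !prime_dvdzM !negb_or -andbA => /and3P[p0 p1 p2].
(* Three distinct residues among 1, 4, 7 modulo 9 would sum to 3 modulo 9, not to 0. *)
have : [\/ (9 %| u1 - u2)%Z, (9 %| u0 - u2)%Z | (9 %| u0 - u1)%Z].
  have [|nd] := boolP (9 %| u1 - u2)%Z; first by move=> ?; apply: Or31.
  have [|nd'] := boolP (9 %| u0 - u2)%Z; first by move=> ?; apply: Or32.
  by apply: Or33; move: nd nd' s1 u01 u11 u21; clear; lia.
case=> /mod9 H; first exact: H.
  have [||v2 [v3 [E2 E3 pe]]] := H u1 u11 _ _ p1.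
  - by move: s1; clear; lia.
  - by rewrite -s2; ring.
  exists v2, v3; split=> //; apply: perm_trans pe.
  by rewrite (perm_catCA [:: u0] [:: u1] [:: u2]).
have [||v2 [v3 [E2 E3 pe]]] := H u2 u21 _ _ p2.
- by move: s1; clear; lia.
- by rewrite -s2; ring.
exists v2, v3; split=> //; apply: perm_trans pe.
by rewrite (perm_catC [:: u0; u1] [:: u2]).
Qed.

End CubicArithmetic.

(** * Weight enumerator of the cubic weight function *)

Section CubicWeightEnumerator.

Variables (K : finFieldType) (p t c : nat) (g : K) (a b : int).
Hypotheses (p_pr : prime p) (p_mod3 : (p %% 3 = 1)%N) (t_gt0 : (0 < t)%N).
Hypotheses (cardKp : #|K| = (p ^ (3 * t))%N) (cardK : #|K| = (3 * c).+1).
Hypothesis g_prim : (3 * c).-primitive_root g.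
Hypotheses (Ea : 4 * p%:Z ^+ t = a ^+ 2 + 27 * b ^+ 2) (a_mod3 : (a %% 3)%Z = 1).
Hypothesis coprime_ap : coprimez a p.

Let q : nat := #|K|.
Local Notation P := (p%:Z ^+ t).
Local Notation wt := (@cubic_weight K p (3 * t) c g).

Lemma cubic_weight0 : wt 0 = 0%N.
Proof.
apply/eqP; rewrite cards_eq0; apply/eqP/setP => s; rewrite !inE mul0r.
by rewrite trace_abs0 ?eqxx // (card_finPcharP cardKp).
Qed.

Lemma cubic_weights :
  exists u0 u1 u2 : int,
  [/\ [/\ (u0 %% 3)%Z = 1, (u1 %% 3)%Z = 1 & (u2 %% 3)%Z = 1],
      [/\ u0 + u1 + u2 = 0, u0 ^+ 2 + u1 ^+ 2 + u2 ^+ 2 = 6 * P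
        & ~~ (p %| u0 * u1 * u2)%Z],
      [/\ 3 * p%:Z * (wt 1)%:Z = p.-1%:Z * (q%:Z - P * u0),
          3 * p%:Z * (wt g)%:Z = p.-1%:Z * (q%:Z - P * u1)
        & 3 * p%:Z * (wt (g ^+ 2))%:Z = p.-1%:Z * (q%:Z - P * u2)]
    & forall y, wt (y * g ^+ 3) = wt y].
Proof.
have p_gt0 := prime_gt0 p_pr.
have [xi xi_prim] := C_prim_root_exists p_gt0.
pose S := @cubic_sum K p t xi.
have sumE := sum_cubic_sum_classes p_pr cardKp cardK g_prim xi_prim.
have sumW := cubic_sum_weight p_pr p_mod3 cardKp cardK g_prim xi_prim.
have inj : injective (fun z : int => z%:~R : algC) by apply: intr_inj.
have intS y : exists2 G : int, S y = G%:~R & (3 %| G - 1)%Z.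
  have [e Ee] := cubic_period_int p_pr p_mod3 cardKp cardK g_prim xi_prim y.
  exists (1 + 3 * e); last by rewrite addrC addKr dvdz_mulr.
  rewrite /S (cubic_sum_period p_pr cardKp cardK g_prim xi_prim) Ee.
  by rewrite rmorphD rmorphM.
have [G0 E0 H0] := intS 1; have [G1 E1 H1] := intS g; have [G2 E2 H2] := intS (g ^+ 2).
have c_gt0 : (0 < c)%N by have := prim_order_gt0 g_prim; rewrite muln_gt0.
have sum1 : G0 + G1 + G2 = 0.
  have := sumE 1%N; under eq_bigr do rewrite expr1.
  rewrite (sum_cubic_sum p_pr cardKp xi_prim) !expr1 -/S E0 E1 E2 -!rmorphD.
  rewrite -[X in X = _ -> _]addr0 => /addrI /esym/eqP.
  by rewrite mulrn_eq0 eqn0Ngt c_gt0 intr_eq0 => /eqP.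
have sum2 : G0 ^+ 2 + G1 ^+ 2 + G2 ^+ 2 = 6 * q%:Z.
  have := sumE 2%N; rewrite (sum_cubic_sum_sq p_pr cardKp cardK g_prim xi_prim).
  rewrite -/S E0 E1 E2 -/q => Es.
  have : q%:Z * (1 + 9 * c%:Z) = q%:Z ^+ 2 + (G0 ^+ 2 + G1 ^+ 2 + G2 ^+ 2) *+ c.
    by apply: inj; rewrite !(rmorphM, rmorphD, rmorphXn, rmorphMn, rmorph1) /= -Es.
  rewrite /q cardK => Es'; apply: (mulfI (_ : c%:Z != 0)); first by rewrite eqz_nat -lt0n.
  by move: Es'; rewrite -mulr_natr; clear; lia.
have sum3 : q%:Z ^+ 3 + (G0 ^+ 3 + G1 ^+ 3 + G2 ^+ 3) *+ c = q%:Z * (cubic_zeros K)%:Z.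
  have := sumE 3%N; rewrite (sum_cubic_sum_cube p_pr cardKp xi_prim).
  rewrite -/S E0 E1 E2 -/q => Es.
  by apply: inj; rewrite !(rmorphM, rmorphD, rmorphXn, rmorphMn) /= Es.
have pM : ~~ (p %| cubic_zeros K)%N.
  rewrite (dvdn_pcharf (card_finPcharP cardKp p_pr)).
  rewrite (cubic_zeros_natr cardK g_prim).
  rewrite -(dvdn_pcharf (card_finPcharP cardKp p_pr)).
  by apply: (coprime_trinomial (m := (3 * t)%N)) => //; rewrite -cardKp.
have [u0 [u1 [u2 [U0 U1 U2 pu]]]] :=
  cubic_sums_divide p_pr t_gt0 cardKp cardK pM sum1 sum2 sum3.
have P_neq0 : P != 0 by rewrite expf_neq0 // eqz_nat -lt0n.
(* Since [P] is 1 modulo 3, dividing by [P] preserves the residue 1 of the cubic sums. *)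
have [d Ed] : exists d, P = 3 * d + 1.
  exists (p ^ t %/ 3)%N%:Z; have := divn_eq (p ^ t) 3; rewrite modn3_exp //.
  have -> : P = (p ^ t)%N%:Z by rewrite -[RHS]natz natrX natz.
  by move: (p ^ t)%N (p ^ t %/ 3)%N => x y; clear; lia.
have mod3 G u : (3 %| G - 1)%Z -> G = P * u -> (u %% 3)%Z = 1.
  by move=> H EG; move: H; rewrite EG Ed mulrDl mul1r -mulrA; move: (d * u); clear; lia.
have weight y (G u : int) : S y = G%:~R -> G = P * u ->
    3 * p%:Z * (wt y)%:Z = p.-1%:Z * (q%:Z - P * u).
  move=> Ey EG; apply: inj; have := sumW y; rewrite -/S Ey EG.
  by rewrite !(rmorphM, rmorphB, rmorphXn) /=.
exists u0, u1, u2; split.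
- by split; [apply: mod3 H0 U0|apply: mod3 H1 U1|apply: mod3 H2 U2].
- split=> //.
    by apply: (mulfI P_neq0); rewrite mulr0 -sum1 U0 U1 U2; ring.
  apply: (mulfI (expf_neq0 2 P_neq0)); transitivity (6 * q%:Z).
    by rewrite -sum2 U0 U1 U2; ring.
  have -> : q%:Z = P ^+ 3 by rewrite /q cardKp (mulnC 3) expnM -[LHS]natz !natrX natz.
  by ring.
- by split; [apply: weight E0 U0|apply: weight E1 U1|apply: weight E2 U2].
move=> y; have := sumW (y * g ^+ 3); rewrite cubic_sum_cubeM ?(prim_root_neq0 g_prim) //.
rewrite -sumW => /mulfI Ew; apply/eqP; rewrite -(eqr_nat algC); apply/eqP/Ew.
by rewrite -natrM pnatr_eq0 muln_eq0 -lt0n.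
Qed.

Lemma cubic_weight_enumerator :
  exists n1 n2 n3 : nat,
  [/\ 3 * p%:Z * n1%:Z = p.-1%:Z * (q%:Z - P * a),
      2 * (3 * p%:Z * n2%:Z) = p.-1%:Z * (2 * q%:Z + P * (a + 9 * b)),
      2 * (3 * p%:Z * n3%:Z) = p.-1%:Z * (2 * q%:Z + P * (a - 9 * b))
    & \sum_(y : K) 'X^(wt y) = 1 + ('X^n1 + 'X^n2 + 'X^n3) *+ c :> {poly int}].
Proof.
have [u0 [u1 [u2 [[m0 m1 m2] [s1 s2 pu] [W0 W1 W2] inv]]]] := cubic_weights.
have pa : ~~ (p %| a)%Z.
  by move: coprime_ap; rewrite coprimez_sym coprimezE prime_coprime.
have [v2 [v3 [V2 V3 pe]]] := repr27_perm p_pr p_mod3 t_gt0 Ea a_mod3 pa m0 m1 m2 s1 s2 pu.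
have nz3p : 3 * p%:Z != 0 by rewrite mulf_neq0 // eqz_nat -lt0n prime_gt0.
(* The weight as a function of [u] alone, so that permuting the [u_i] permutes the exponents; the
   division is exact at the three values in use. *)
pose N (u : int) : nat := `|((p.-1%:Z * (q%:Z - P * u)) %/ (3 * p%:Z))%Z|%N.
have NE n u : 3 * p%:Z * n%:Z = p.-1%:Z * (q%:Z - P * u) -> N u = n.
  by move=> En; rewrite /N -En mulKz.
have NP u : u \in [:: a; v2; v3] -> 3 * p%:Z * (N u)%:Z = p.-1%:Z * (q%:Z - P * u).
  rewrite -(perm_mem pe) !inE => /or3P[]/eqP->.
  - by rewrite (NE _ _ W0).
  - by rewrite (NE _ _ W1).
  - by rewrite (NE _ _ W2).
exists (N a), (N v2), (N v3); split.
- by rewrite NP // !inE eqxx.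
- rewrite NP ?inE ?eqxx ?orbT // -[a + _]opprK -V2; ring.
- rewrite NP ?inE ?eqxx ?orbT // -[a - _]opprK -V3; ring.
rewrite (sum_cubic_classes cardK g_prim (f := fun y => 'X^(wt y))) => [|y]; last by rewrite inv.
rewrite cubic_weight0 expr0 -(NE _ _ W0) -(NE _ _ W1) -(NE _ _ W2).
have : \sum_(u <- [:: u0; u1; u2]) 'X^(N u) =
       \sum_(u <- [:: a; v2; v3]) 'X^(N u) :> {poly int} by apply: perm_big.
by rewrite !big_cons !big_nil !addr0 !addrA => ->.
Qed.

End CubicWeightEnumerator.

(** * Descent to the subfield *)

Section FrobeniusFixedField.

Variables (F : finFieldType) (p m : nat) (pcharFp : p \in [pchar F]).

(* The phantom argument lets the closure instance find [pcharFp] by unification. *)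
Definition frob_fixed of p \in [pchar F] : {pred F} := [pred x | x ^+ (p ^ m) == x].

Fact frob_fixed_divring : divring_closed (frob_fixed pcharFp).
Proof.
have frobD (x y : F) := exprD_pchar_pow pcharFp m x y.
split=> [|x y|x y]; rewrite !inE ?expr1n // => /eqP Ex /eqP Ey.
  by rewrite eq_sym subr_eq -{2}Ey -frobD subrK Ex.
by rewrite exprMn exprVn Ex Ey.
Qed.

HB.instance Definition _ :=
  GRing.isDivringClosed.Build F (frob_fixed pcharFp) frob_fixed_divring.

Record frob_field := FrobField { frob_val : F; _ : frob_val \in frob_fixed pcharFp }.

HB.instance Definition _ := [isSub for frob_val].
HB.instance Definition _ := [Finite of frob_field by <:].
HB.instance Definition _ := [SubChoice_isSubIntegralDomain of frob_field by <:].
HB.instance Definition _ := [SubIntegralDomain_isSubField of frob_field by <:].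

Lemma frobenius_subfield :
  exists (K : finFieldType) (f : {rmorphism K -> F}),
    forall x : F, x ^+ (p ^ m) = x <-> exists y, x = f y.
Proof.
exists frob_field, (val : {rmorphism frob_field -> F}) => x.
split=> [/eqP xq|[[y yq] ->]]; last exact/eqP.
by exists (FrobField xq).
Qed.

End FrobeniusFixedField.

Section RelativeTrace.

Variables (F : finFieldType) (p m r : nat).
Hypotheses (p_pr : prime p) (cardF : #|F| = ((p ^ m) ^ r)%N).

Let pcharFp : p \in [pchar F].
Proof. by apply: (card_finPcharP (n := (m * r)%N)); rewrite // cardF expnM. Qed.

(** The trace from [F] to its subfield of order [p ^ m], computed inside [F]. *)
Definition rel_trace (z : F) : F := \sum_(j < r) z ^+ ((p ^ m) ^ j).

Lemma rel_trace_fixed (z : F) : rel_trace z ^+ (p ^ m) = rel_trace z.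
Proof.
rewrite (expr_sum_pchar_pow pcharFp) /rel_trace.
have r_gt0 : (0 < r)%N.
  by have := finNzRing_gt1 F; rewrite cardF; case: (r) => //; rewrite expn0.
rewrite -(big_mkord xpredT (fun j => (z ^+ ((p ^ m) ^ j)) ^+ (p ^ m))).
rewrite -(big_mkord xpredT (fun j => z ^+ ((p ^ m) ^ j))).
rewrite -(prednK r_gt0) big_nat_recr //= [RHS]big_nat_recl //= addrC.
rewrite -exprM -expnSr prednK // -cardF expf_card; congr (_ + _).
by apply: eq_bigr => j _; rewrite -exprM -expnSr.
Qed.

Lemma trace_abs_tower (z : F) : trace_abs p (m * r) z = trace_abs p m (rel_trace z).
Proof.
rewrite /trace_abs (big_ord_mul r m (fun i => z ^+ (p ^ i))) exchange_big /=.
apply: eq_bigr => i _; rewrite (expr_sum_pchar_pow pcharFp); apply: eq_bigr => j _.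
by rewrite -exprM -expnM -expnD.
Qed.

Lemma expr_pow_fixed (x : F) j : x ^+ (p ^ m) = x -> x ^+ ((p ^ m) ^ j) = x.
Proof.
by move=> xq; elim: j => [|j IHj]; rewrite ?expn0 ?expr1 // expnSr exprM IHj.
Qed.

Lemma rel_traceM (z x : F) : x ^+ (p ^ m) = x -> rel_trace (z * x) = rel_trace z * x.
Proof.
move=> xq; rewrite /rel_trace mulr_suml; apply: eq_bigr => j _.
by rewrite exprMn (expr_pow_fixed j xq).
Qed.

(* [beta ^+ j], [j < r], is a Kummer basis of [F] over the subfield of order
   [p ^ m]; its dual basis is [beta ^- j / r]. *)
Lemma rel_trace_kummer (beta gamma : F) :
  beta != 0 -> (beta ^+ r) ^+ (p ^ m) = beta ^+ r ->
  (forall i, (0 < i < r)%N -> beta ^+ ((p ^ m) ^ i) != beta) ->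
  \sum_(j < r) beta ^- j * rel_trace (gamma * beta ^+ j) = gamma *+ r.
Proof.
move=> nz_b br_fixed b_conj.
have r_gt0 : (0 < r)%N.
  by have := finNzRing_gt1 F; rewrite cardF; case: (r) => //; rewrite expn0.
transitivity (\sum_(i < r) gamma ^+ ((p ^ m) ^ i) *
    \sum_(j < r) (beta ^+ ((p ^ m) ^ i) / beta) ^+ j).
  under eq_bigr do rewrite mulr_sumr; rewrite exchange_big; apply: eq_bigr => i _ /=.
  rewrite mulr_sumr; apply: eq_bigr => j _.
  by rewrite exprMn expr_div_n -!exprM mulnC [RHS]mulrA mulrC.
rewrite (bigD1 (Ordinal r_gt0)) //= expn0 !expr1 divff //.
under [X in _ * X]eq_bigr do rewrite expr1n.
rewrite sumr_const card_ord mulr_natr big1 ?addr0 // => i ni.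
have i_gt0 : (0 < i)%N by rewrite lt0n -val_eqE in ni *.
(* For [i > 0] this quotient of conjugates is an [r]-th root of unity other than 1, so its geometric
   sum vanishes; only [i = 0] contributes. *)
have zr : (beta ^+ ((p ^ m) ^ i) / beta) ^+ r = 1.
  by rewrite expr_div_n -exprM mulnC exprM expr_pow_fixed // divff ?expf_neq0.
have /eqP := subrX1 (beta ^+ ((p ^ m) ^ i) / beta) r.
rewrite zr subrr eq_sym mulf_eq0 subr_eq0 => /orP[/eqP z1|/eqP->]; last by rewrite mulr0.
have := b_conj i; rewrite i_gt0 ltn_ord => /(_ isT) /eqP[].
by rewrite -[LHS](divfK nz_b) z1 mul1r.
Qed.

End RelativeTrace.

(** * Expansion of the weight enumerator *)

Lemma trinomial_fact n i j k : (i + j + k <= n ->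
  'C(n, i) * 'C(n - i, j) * 'C(n - i - j, k) * (i`! * j`! * k`! * (n - (i + j + k))`!)
    = n`!)%N.
Proof.
move=> le_n; have le_i : (i <= n)%N by lia.
have le_j : (j <= n - i)%N by lia.
have le_k : (k <= n - i - j)%N by lia.
rewrite -(bin_fact le_i) -(bin_fact le_j) -(bin_fact le_k).
have -> : (n - (i + j + k) = n - i - j - k)%N by lia.
move: 'C(_, _) 'C(_, _) 'C(_, _) i`! j`! k`! (n - i - j - k)`!; clear; lia.
Qed.

Lemma multinom3E i j k :
  multinom3 i j k = ('C(i + j + k, i) * 'C(i + j + k - i, j) * 'C(i + j + k - i - j, k))%N.
Proof.
rewrite /multinom3 -(trinomial_fact (leqnn (i + j + k))) subnn fact0 muln1.
by rewrite mulnK // !muln_gt0 !fact_gt0.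
Qed.

Lemma bin_multinom3 n i j k :
  ('C(n, i) * 'C(n - i, j) * 'C(n - i - j, k) =
    if i + j + k <= n then 'C(n, i + j + k) * multinom3 i j k else 0)%N.
Proof.
case: leqP => [le_n|lt_n].
  have fact_pos : (0 < i`! * j`! * k`! * (n - (i + j + k))`!)%N.
    by rewrite !muln_gt0 !fact_gt0.
  apply/eqP; rewrite -(eqn_pmul2r fact_pos) trinomial_fact // -(bin_fact le_n).
  rewrite -[X in (_ * (X * _))%N](trinomial_fact (leqnn (i + j + k))) subnn fact0.
  by rewrite multinom3E muln1 !mulnA.
have [lt_i|le_i] := ltnP n i; first by rewrite bin_small.
have [lt_j|le_j] := ltnP (n - i) j; first by rewrite (bin_small lt_j) muln0.
by rewrite (@bin_small (n - i - j)) ?muln0 //; lia.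
Qed.

(** The added binomials are zero; the common bound makes the nested ranges independent of the outer
    indices. *)
Lemma exprDn_wide (R : comNzRingType) (x y : R) n N : (n <= N)%N ->
  (x + y) ^+ n = \sum_(i < N.+1) (x ^+ (n - i) * y ^+ i) *+ 'C(n, i).
Proof.
move=> le_n; rewrite exprDn (big_ord_widen N.+1 (fun i => x ^+ (n - i) * y ^+ i *+ 'C(n, i))) //.
rewrite [RHS](bigID (fun i : 'I_N.+1 => (i < n.+1)%N)) /= [X in _ + X]big1 ?addr0 // => i.
by rewrite -ltnNge => lt_n; rewrite bin_small ?mulr0n.
Qed.

Lemma quadrinomial (R : comNzRingType) (x y z : R) n :
  (1 + (x + y + z)) ^+ n =
    \sum_(i < n.+1) \sum_(j < n.+1) \sum_(k < n.+1 | (i + j + k <= n)%N)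
      (x ^+ i * y ^+ j * z ^+ k) *+ ('C(n, i + j + k) * multinom3 i j k).
Proof.
(* In this order the successive binomial expansions peel off [x], then [y], then [z]. *)
have -> : 1 + (x + y + z) = 1 + z + y + x by ring.
rewrite (exprDn_wide _ _ (leqnn n)); apply: eq_bigr => i _.
rewrite (@exprDn_wide _ _ _ (n - i) n) ?leq_subr // mulr_suml -sumrMnl.
apply: eq_bigr => j _.
rewrite (@exprDn_wide _ _ _ (n - i - j) n); last by rewrite -subnDA leq_subr.
rewrite mulr_suml -sumrMnl mulr_suml -sumrMnl [RHS]big_mkcond; apply: eq_bigr => k _ /=.
transitivity ((x ^+ i * y ^+ j * z ^+ k) *+
    ('C(n, i) * 'C(n - i, j) * 'C(n - i - j, k))).
  rewrite expr1n mul1r !mulrnAl -!mulrnA -mulrA mulrC (mulrC (y ^+ j)).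
  by congr (_ *+ _); move: 'C(_, _) 'C(_, _) 'C(_, _); clear; lia.
by rewrite bin_multinom3; case: ifP.
Qed.

Lemma coef_sum_Xn (T : finType) (f : T -> nat) w :
  (\sum_x 'X^(f x) : {poly int})`_w = #|[set x | f x == w]|%:Z.
Proof.
rewrite coef_sum -sum1_card -natz natr_sum [RHS]big_mkcond /=.
by apply: eq_bigr => x _; rewrite coefXn inE eq_sym; case: eqP.
Qed.

Lemma Psi_mod (r q i : nat) : (q %% r = 1 -> Psi i q = i %[mod r])%N.
Proof.
move=> q1; rewrite /Psi; elim: i => [|i IHi]; first by rewrite big_ord0.
rewrite big_ord_recr /= -modnDm IHi -modnXm q1 exp1n modnDm addn1 //.
Qed.

Lemma card_set_ord n (P : pred nat) : #|[set i : 'I_n | P i]| = (\sum_(i < n) P i)%N.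
Proof. by rewrite -sum1_card big_mkcond; apply: eq_bigr => i _; rewrite inE; case: (P i). Qed.

(** * Reduction of the code to the subfield *)

Section Reduction.

Variables (F : finFieldType) (p m r c : nat) (omega : F).
Hypotheses (p_pr : prime p) (r_pr : prime r) (neq_pr : p != r) (co3r : coprime 3 r).
Hypotheses (Eq : (p ^ m = (3 * c).+1)%N) (q_mod_r : (p ^ m %% r = 1)%N).
Hypotheses (cardF : #|F| = ((p ^ m) ^ r)%N) (om_prim : (#|F|.-1).-primitive_root omega).

Local Notation q := (p ^ m)%N.
Let k : nat := (3 * Psi r q %/ r)%N.

Let r_gt0 : (0 < r)%N := prime_gt0 r_pr.

Let order_Psi i : ((q ^ i).-1 = 3 * c * Psi i q)%N.
Proof. by rewrite predn_exp /Psi Eq. Qed.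

Let dvd_r_Psi i : (r %| Psi i q)%N = (r %| i)%N.
Proof. by rewrite /dvdn Psi_mod. Qed.

Let k_r : (k * r = 3 * Psi r q)%N.
Proof. by rewrite /k divnK // dvdn_mull // dvd_r_Psi. Qed.

Let order_k : (#|F|.-1 = k * (r * c))%N.
Proof. by rewrite cardF order_Psi mulnA k_r mulnAC. Qed.

Let order_gt0 : (0 < k * (r * c))%N.
Proof. by rewrite -order_k (prim_order_gt0 om_prim). Qed.

Let c_gt0 : (0 < c)%N.
Proof. by move: order_gt0; rewrite !muln_gt0 => /and3P[]. Qed.

Let k_gt0 : (0 < k)%N.
Proof. by move: order_gt0; rewrite !muln_gt0 => /andP[]. Qed.

(** As [Psi r q = (q ^ r - 1) / (q - 1)], this generates the units of the subfield. *)
Let g0 : F := omega ^+ Psi r q.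
Let beta : F := omega ^+ k.

Let g0_prim : (3 * c).-primitive_root g0.
Proof.
have dvd : (3 * c %| #|F|.-1)%N by rewrite cardF order_Psi dvdn_mulr.
have := dvdn_prim_root om_prim dvd.
by rewrite cardF order_Psi mulKn // muln_gt0 c_gt0.
Qed.

Let g0_fixed : g0 ^+ q = g0.
Proof. by rewrite Eq exprS (prim_expr_order g0_prim) mulr1. Qed.

Let om_neq0 : omega != 0.
Proof.
apply/eqP => om0; have /eqP := prim_expr_order om_prim.
by rewrite om0 expr0n order_k eqn0Ngt order_gt0 eq_sym oner_eq0.
Qed.

Let beta_r : beta ^+ r = g0 ^+ 3.
Proof. by rewrite -!exprM k_r mulnC. Qed.

Let beta_r_fixed : (beta ^+ r) ^+ q = beta ^+ r.
Proof. by rewrite beta_r exprAC g0_fixed. Qed.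

(** Equality would mean that [k r c] divides [k (q ^ i - 1) = 3 k c Psi i q], hence that [r] divides
    [Psi i q], which is [i] modulo [r]. *)
Let beta_conj i : (0 < i < r)%N -> beta ^+ (q ^ i) != beta.
Proof.
case/andP=> i_gt0 lt_ir; rewrite -exprM (eq_prim_root_expr om_prim) order_k.
have qi_gt0 : (0 < q ^ i)%N by rewrite expn_gt0 Eq.
rewrite eqn_mod_dvd; last by rewrite leq_pmulr.
rewrite -{3}[k]muln1 -mulnBr dvdn_pmul2l // subn1 order_Psi mulnAC dvdn_pmul2r //.
by rewrite Gauss_dvdr ?dvd_r_Psi ?gtnNdvd // coprime_sym.
Qed.

Let pcharFp : p \in [pchar F].
Proof. by apply: (card_finPcharP (n := (m * r)%N)); rewrite // cardF expnM. Qed.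

Lemma weight_enumerator_reduction :
  exists (K : finFieldType) (g : K),
  [/\ #|K| = q, (3 * c).-primitive_root g
    & \sum_(gamma : F) 'X^(cw_weight p (m * r) k omega gamma) =
      (\sum_(y : K) 'X^(cubic_weight p m c g y)) ^+ r :> {poly int}].
Proof.
have [K [f fP]] := frobenius_subfield m pcharFp.
have [g Eg] : exists g, g0 = f g by apply/fP.
have g_prim : (3 * c).-primitive_root g by rewrite -(fmorph_primitive_root f) -Eg.
have cardK : #|K| = q.
  have KE : [set~ (0 : K)] = [set g ^+ i | i : 'I_(3 * c)].
    apply/setP => y; rewrite !inE; apply/idP/imsetP => [nz_y|[i _ ->]].
      have [|i ->] := prim_rootP g_prim (x := y); last by exists i.
      apply: (mulfI nz_y); rewrite -exprS mulr1 -Eq; apply: (fmorph_inj f).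
      by rewrite rmorphXn; apply/fP; exists y.
    by rewrite expf_neq0 // -(fmorph_eq0 f) -Eg expf_neq0.
  have := cardsC1 (0 : K); rewrite KE card_imset ?card_ord.
    by rewrite Eq => ->; rewrite prednK // ltnW // finNzRing_gt1.
  move=> i j /eqP; rewrite (eq_prim_root_expr g_prim) => /eqP.
  by rewrite !modn_small // => /val_inj.
exists K, g; split=> //.
(* Inverse of the embedding; the default 0 is never reached, since relative traces are fixed by
   Frobenius. *)
pose finv x : K := odflt 0 [pick y | f y == x].
have finvK x : x ^+ q = x -> f (finv x) = x.
  move=> /fP[y Ey]; rewrite /finv; case: pickP => [z /eqP //|/(_ y)].
  by rewrite Ey eqxx.
pose Y (gamma : F) : {ffun 'I_r -> K} :=
  [ffun j : 'I_r => finv (rel_trace p m r (gamma * beta ^+ j))].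
have YE gamma j : f (Y gamma j) = rel_trace p m r (gamma * beta ^+ j).
  by rewrite ffunE finvK // rel_trace_fixed.
have r_neq0 : r%:R != 0 :> F by rewrite -(dvdn_pcharf pcharFp) dvdn_prime2.
(* The Kummer expansion recovers [r] times [gamma] from [Y gamma], and [r] is invertible because
   [p != r]. *)
have Y_inj : injective Y.
  move=> x y Exy; apply: (mulfI r_neq0); rewrite !mulr_natl.
  have kummer x0 := rel_trace_kummer cardF x0 (expf_neq0 k om_neq0) beta_r_fixed beta_conj.
  rewrite -!kummer; apply: eq_bigr => j _.
  by rewrite -!YE Exy.
have Y_bij : bijective Y.
  by apply: inj_card_bij Y_inj _; rewrite card_ffun card_ord cardK cardF.
have wtE gamma :
    cw_weight p (m * r) k omega gamma = (\sum_(j < r) cubic_weight p m c g (Y gamma j))%N.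
  rewrite /cw_weight (card_set_ord _ (fun i =>
    trace_abs p (m * r) (gamma * omega ^+ (k * i)) != 0)).
  rewrite order_k mulKn //.
  (* Writing a coordinate as [r s + j] splits [omega ^ (k (r s + j))] into [beta ^ j] times the cube
     [g0 ^ (3 s)], because [beta ^ r = g0 ^ 3]. *)
  transitivity (\sum_(s < c) \sum_(j < r)
      (trace_abs p (m * r) (gamma * omega ^+ (k * (r * s + j))) != 0)%R)%N.
    exact: (big_ord_mul c r (fun i =>
      (trace_abs p (m * r) (gamma * omega ^+ (k * i)) != 0) : nat)).
  rewrite exchange_big /=; apply: eq_bigr => j _.
  rewrite /cubic_weight (card_set_ord _ (fun s =>
    trace_abs p m (Y gamma j * g ^+ (3 * s)) != 0)).
  apply: eq_bigr => s _; congr (nat_of_bool (~~ _)).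
  rewrite -(fmorph_eq0 f) /trace_abs rmorph_sum; under [in RHS]eq_bigr do rewrite rmorphXn.
  rewrite -!/(trace_abs _ _ _) (trace_abs_tower p_pr cardF) rmorphM YE rmorphXn -Eg.
  rewrite -rel_traceM //; last by rewrite exprAC g0_fixed.
  congr (trace_abs p m (rel_trace p m r _) == 0).
  rewrite -mulrA; congr (_ * _); rewrite mulnDr exprD [RHS]mulrC /beta -!exprM.
  by rewrite mulnA k_r [in RHS]mulnA (mulnC (Psi r q)).
under eq_bigr do rewrite wtE.
(* The [r]-th power expands into a sum over all functions from ['I_r] to [K], which [Y] matches with
   the elements of [F]. *)
rewrite -[r in RHS]card_ord -prodr_const bigA_distr_bigA /= (reindex Y); last exact: onW_bij.
apply: eq_bigr => gamma _.
exact: (big_morph (fun n => 'X^n) (fun i j => exprD 'X i j) (expr0 'X)).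
Qed.

End Reduction.

(** * Weights and frequencies of the code *)

Theorem theorem5p1 (p r t : nat) (a b : int)
  (F : finFieldType) (omega : F) :
  prime p -> prime r -> p != r ->
  (p %% 3 = 1)%N -> coprime 3 r -> (1 <= t)%N ->
  let m := (3 * t)%N in
  let q := (p ^ m)%N in
  let c := ((q - 1) %/ 3)%N in
  let k := ((3 * Psi r q) %/ r)%N in
  (q %% r = 1)%N ->
  4 * (p%:Z) ^+ t = a ^+ 2 + 27 * b ^+ 2 ->
  (a %% 3)%Z = 1 ->
  coprimez a p ->
  #|F| = (q ^ r)%N ->
  (#|F|.-1).-primitive_root omega ->
  forall w : nat,
    cw_freq p (m * r) k omega w =
    (\sum_(l1 < r.+1) \sum_(l2 < r.+1) \sum_(l3 < r.+1
       | (l1 + l2 + l3 <= r)%N &&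
         ((w%:Q : rat) ==
             ((p%:Q - 1) / (3 * p%:Q)) *
             ((l1 + l2 + l3)%:Q * q%:Q +
              ((a%:~R : rat) * (((l2 + l3)%:Q) / 2 - l1%:Q) +
               9 * (b%:~R : rat) / 2 * (l2%:Q - l3%:Q)) * (p%:Q) ^+ t))%R)
       'C(r, l1 + l2 + l3) * multinom3 l1 l2 l3 * c ^ (l1 + l2 + l3))%N.
Proof.
move=> p_pr r_pr neq_pr p_mod3 co3r t_gt0 m q c k q_mod_r Ea a_mod3 co_ap cardF om_prim w.
have Eq : (p ^ m = (3 * c).+1)%N.
  have := modn3_exp m p_mod3; rewrite /c /q; move: (p ^ m)%N; clear; lia.
have [K [g [cardK g_prim enumF]]] :=
  weight_enumerator_reduction p_pr r_pr neq_pr co3r Eq q_mod_r cardF om_prim.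
have cardK' : #|K| = (3 * c).+1 by rewrite cardK.
have [n1 [n2 [n3 [N1 N2 N3 enumK]]]] :=
  cubic_weight_enumerator p_pr p_mod3 t_gt0 cardK cardK' g_prim Ea a_mod3 co_ap.
rewrite cardK -/q in N1 N2 N3.
have p_gt0 := prime_gt0 p_pr.
have nzp : p%:Q != 0 by rewrite intr_eq0 eqz_nat -lt0n.
have Ep : p.-1%:Z%:Q = p%:Q - 1.
  by rewrite -[in RHS](prednK p_gt0) -addn1 PoszD rmorphD addrK.
have castQ (x y : int) : x = y -> x%:Q = y%:Q by move->.
(* In the expanded enumerator [l1], [l2], [l3] count the coordinates in the three cubic classes, the
   term 1 standing for a zero coordinate; the stated weight is the exponent of that monomial. *)
have weightE (l1 l2 l3 : nat) :
    ((p%:Q - 1) / (3 * p%:Q)) *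
      ((l1 + l2 + l3)%N%:Q * q%:Q +
       (a%:~R * ((l2 + l3)%N%:Q / 2 - l1%:Q) + 9 * b%:~R / 2 * (l2%:Q - l3%:Q)) * p%:Q ^+ t)
    = (n1 * l1 + n2 * l2 + n3 * l3)%N%:Q.
  clear -N1 N2 N3 nzp Ep castQ; clearbody q.
  have := castQ _ _ N1; have := castQ _ _ N2; have := castQ _ _ N3.
  rewrite !PoszD !PoszM !(rmorphM, rmorphD, rmorphB, rmorphXn, rmorphN) /= Ep.
  set P := p%:Q ^+ t; set Q := q%:Q; set A : rat := a%:~R; set B : rat := b%:~R.
  move=> M3 M2 M1.
  have -> : n1%:Q = (p%:Q - 1) * (Q - P * A) / (3 * p%:Q) by rewrite -M1; field.
  have -> : n2%:Q = (p%:Q - 1) * (2 * Q + P * (A + 9 * B)) / (2 * (3 * p%:Q)).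
    by rewrite -M2; field.
  have -> : n3%:Q = (p%:Q - 1) * (2 * Q + P * (A - 9 * B)) / (2 * (3 * p%:Q)).
    by rewrite -M3; field.
  by field.
have : (cw_freq p (m * r) k omega w)%:Z =
    (\sum_(gamma : F) 'X^(cw_weight p (m * r) k omega gamma) : {poly int})`_w.
  by rewrite coef_sum_Xn.
rewrite enumF enumK !mulrnDl quadrinomial coef_sum => Ew.
apply/eqP; rewrite -eqz_nat; apply/eqP; rewrite {}Ew -[RHS]natz natr_sum.
apply: eq_bigr => l1 _; rewrite coef_sum natr_sum; apply: eq_bigr => l2 _.
rewrite coef_sum natr_sum [LHS]big_mkcond [RHS]big_mkcond /=; apply: eq_bigr => l3 _.
case: leqP => //= le_h.
(* In the statement these sums are taken in ['I_r.+1], that is, modulo [r.+1]. *)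
have -> : (((l1 + l2) %% r.+1 + l3) %% r.+1 = l1 + l2 + l3)%N.
  by rewrite modnDml modn_small.
have -> : ((l2 + l3) %% r.+1 = l2 + l3)%N.
  by rewrite modn_small // ltnS (leq_trans _ le_h) // -addnA leq_addl.
rewrite weightE eqr_int eqz_nat !exprMn_n !(mulrnAl, mulrnAr) -!mulrnA -!exprM -!exprD.
rewrite coefMn coefXn !expnD; case: eqP => _; last by rewrite mul0rn.
rewrite -[RHS]mulr1 mulr_natl; congr (_ *+ _).
by move: 'C(_, _) (multinom3 _ _ _) (c ^ l1)%N (c ^ l2)%N (c ^ l3)%N; clear; lia.
Qed.
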